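(* Let $n$ be a positive integer and let $I\subseteq\{2,3,\dots,n-1\}$ be a (possibly empty) index set. Then there exists a basic formal matrix ring $R$ of order $n$ with a Nakayama permutation $\pi=(1~2~\dots~n)$ and an essential right socle such that, for all $i,j$, the coordinate bimodule $B_{i,j}$ is nonzero if and only if it is a local corner (i.e. $i=j$), or a pairing coordinate bimodule (i.e. $j\equiv i+1$), or $j\equiv i+k$ or $j\equiv i-k+1$ for some $k\in I$, where all congruences are modulo $n$.
   Context: Rings are associative and unital; $J(R)$ is the Jacobson radical. Formal matrix ring of order $n$: given local rings $R_1,\dots,R_n$ (local corners), $R_i$-$R_j$-bimodules $B_{i,j}$ (coordinate bimodules) with $B_{i,i}=R_i$, and $R_i$-$R_k$-bimodule homomorphisms $\varphi_{i,j,k}\colon B_{i,j}\otimes_{R_j}B_{j,k}\to B_{i,k}$, written $ab:=\varphi_{i,j,k}(a\otimes b)$, where $\varphi_{i,i,j}$ and $\varphi_{i,j,j}$ are the bimodule actions and $(ab)c=a(bc)$ for all $a\in B_{i,j}$, $b\in B_{j,k}$, $c\in B_{k,l}$. The ring $R$ is the set of $n\times n$ matrices whose $(i,j)$ entry lies in $B_{i,j}$, with the usual matrix addition and multiplication. The canonical idempotent $e_i$ is the matrix with $1_{R_i}$ at position $(i,i)$ and zeros elsewhere. $R$ is basic if the right modules $e_1R,\dots,e_nR$ are pairwise non-isomorphic. $R$ has an essential right socle if its right socle is essential as a right ideal. Nakayama permutation: a basic formal matrix ring $R$ of order $n$ is a ring with a Nakayama permutation $\pi\in S_n$ if for each $i\le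 n$ one has $soc(e_iR)\cong top(e_{\pi(i)}R)$ as right $R$-modules and $soc(Re_{\pi(i)})\cong top(Re_i)$ as left $R$-modules, where $top(M)=M/MJ(R)$ (resp. $M/J(R)M$). The bimodules $B_{i,\pi(i)}$ are then called pairing coordinate bimodules. Here $(1~2~\dots~n)$ is the cycle $i\mapsto i+1$ modulo $n$. *)

(* Defs.v *)
From HB Require Import structures.
From mathcomp Require Import all_boot all_order all_algebra.
From mathcomp Require Import generic_quotient ring_quotient perm boolp.

Set Implicit Arguments.
Unset Strict Implicit.
Unset Printing Implicit Defensive.
Import GRing.Theory.
Local Open Scope ring_scope.
Local Open Scope quotient_scope.

(* Modules over a ring A are the left modules [lmodType A]; right modules are
   left modules over the converse ring A^c, whose product is x * y = (y * x)_A.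
   Submodules are the boolean predicates [submodClosed M]; boolp makes every
   submodule of this form. *)

Section Submodule.
Variables (A : pzRingType) (M : lmodType A) (N : submodClosed M).

Definition sub_carrier : Type := {x : M | x \in N}.
HB.instance Definition _ := SubChoice.on sub_carrier.
HB.instance Definition _ := [SubChoice_isSubLmodule of sub_carrier by <:].

Definition submodule : lmodType A := sub_carrier.

End Submodule.

Section QuotientModule.
Variables (A : pzRingType) (M : lmodType A) (N : submodClosed M).

Definition sub_pred : M -> bool := fun x => x \in N.
Fact sub_pred_zmod : zmod_closed sub_pred.
Proof. exact: (submodClosedP N : zmod_closed N). Qed.
HB.instance Definition _ := GRing.isZmodClosed.Build M sub_pred sub_pred_zmod.


Definition sub_zmod : zmodClosed M := GRing.ZmodClosed.clone M sub_pred _.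

Local Notation Q := (Quotient.quot sub_zmod).

Definition quot_carrier : Type := Q.
HB.instance Definition _ := GRing.Zmodule.on quot_carrier.

Definition quot_scale (a : A) (q : quot_carrier) : quot_carrier :=
  \pi_Q (a *: repr q).

Lemma quot_scale_pi (a : A) (x : M) :
  quot_scale a (\pi_Q x) = \pi_Q (a *: x) :> Q.
Proof.
apply/eqP; rewrite /quot_scale -Quotient.idealrBE -scalerBr.
suff: repr (\pi_Q x) - x \in N by move=> /(rpredZ a).
by rewrite -[_ \in N]/(_ \in sub_zmod) Quotient.idealrBE reprK.
Qed.

Lemma quot_scaleA a b (q : quot_carrier) :
  quot_scale a (quot_scale b q) = quot_scale (a * b) q.
Proof.
by rewrite -[q](@reprK _ Q) !quot_scale_pi scalerA.
Qed.

Lemma quot_scale1 : left_id 1 quot_scale.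
Proof. by move=> q; rewrite -[q](@reprK _ Q) quot_scale_pi scale1r. Qed.

Lemma quot_scaleDr : right_distributive quot_scale +%R.
Proof.
move=> a p q; rewrite -[p](@reprK _ Q) -[q](@reprK _ Q).
have piD (x y : M) : \pi_Q x + \pi_Q y = \pi_Q (x + y) :> Q.
  by rewrite !piE.
by rewrite piD !quot_scale_pi piD scalerDr.
Qed.

Lemma quot_scaleDl (q : quot_carrier) :
  {morph quot_scale^~ q : a b / a + b}.
Proof.
move=> a b; rewrite -[q](@reprK _ Q) !quot_scale_pi scalerDl.
by rewrite [LHS]raddfD.
Qed.

HB.instance Definition _ := GRing.Zmodule_isLmodule.Build A quot_carrier
  quot_scaleA quot_scale1 quot_scaleDr quot_scaleDl.

Definition quot_module : lmodType A := quot_carrier.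

End QuotientModule.

Definition module_iso (A : pzRingType) (U V : lmodType A) : Prop :=
  exists f : {linear U -> V}, bijective f.

Section ModuleNotions.
Variables (A : pzRingType) (M : lmodType A).

Definition gen_pred (X : M -> Prop) : M -> bool := fun x =>
  `[< forall N : submodClosed M, (forall y, X y -> y \in N) -> x \in N >].

Lemma gen_closed X : submod_closed (gen_pred X).
Proof.
split=> [|a u v uX vX]; apply/asboolP => N XN; first exact: rpred0.
by apply: rpredD; [apply: rpredZ|]; [move/asboolP: uX|move/asboolP: vX];
  apply.
Qed.

HB.instance Definition _ X :=
  GRing.isSubmodClosed.Build A M (gen_pred X) (gen_closed X).

(* The intersection of the submodules containing X. *)
Definition gen (X : M -> Prop) : submodClosed M :=
  GRing.SubmodClosed.clone A M (gen_pred X) _.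

Definition nonzero_submod (N : submodClosed M) : Prop :=
  exists2 x : M, x \in N & x <> 0.

Definition simple_submod (N : submodClosed M) : Prop :=
  nonzero_submod N /\
  forall L : submodClosed M,
    {subset L <= N} -> nonzero_submod L -> {subset N <= L}.

Definition maximal_submod (N : submodClosed M) : Prop :=
  (exists x : M, x \notin N) /\
  forall L : submodClosed M,
    {subset N <= L} -> (exists x : M, x \notin L) -> {subset L <= N}.

Definition essential_submod (N : submodClosed M) : Prop :=
  forall L : submodClosed M, nonzero_submod L ->
    exists x : M, [/\ x \in L, x \in N & x <> 0].

(* The sum of all simple submodules. *)
Definition soc : submodClosed M :=
  gen (fun x => exists2 N : submodClosed M, simple_submod N & x \in N).

Definition mod_top (J : A -> Prop) : lmodType A :=
  quot_module (gen (fun x => exists a y, J a /\ x = a *: y)).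

End ModuleNotions.

Arguments soc {A} M.
Arguments mod_top {A} M J.

Section RingNotions.
Variable A : pzRingType.

(* The left ideal A e. Over the converse ring R^c it is the right ideal e R. *)
Definition principal_pred (e : A) : A^o -> bool :=
  fun x => `[< exists a : A, x = a * e >].

Lemma principal_closed e : submod_closed (principal_pred e).
Proof.
split=> [|a u v /asboolP[b ->] /asboolP[c ->]]; apply/asboolP.
  by exists 0; rewrite mul0r.
by exists (a * b + c); rewrite mulrDl -mulrA.
Qed.

HB.instance Definition _ e :=
  GRing.isSubmodClosed.Build A A^o (principal_pred e) (principal_closed e).

Definition principal (e : A) : submodClosed A^o :=
  GRing.SubmodClosed.clone A A^o (principal_pred e) _.

(* J(A): the intersection of the maximal left ideals. *)
Definition jacobson (a : A) : Prop :=
  forall L : submodClosed A^o, maximal_submod L -> (a : A^o) \in L.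

(* A has exactly one maximal left ideal (in particular A is nonzero). *)
Definition local_ring : Prop :=
  exists2 L : submodClosed A^o, maximal_submod L &
    forall L' : submodClosed A^o, maximal_submod L' -> L' =i L.

End RingNotions.

Definition left_principal (R : pzRingType) (e : R) : lmodType R :=
  submodule (principal e).

Definition right_principal (R : pzRingType) (e : R) : lmodType R^c :=
  submodule (principal (e : R^c)).

Definition essential_right_socle (R : pzRingType) : Prop :=
  essential_submod (soc ((R^c)^o : lmodType R^c)).

(* The structure of a formal matrix ring of order n, apart from the locality
   of the corners. [bimodM i j k] is (a, b) |-> phi_{i,j,k} (a (x) b). The
   diagonal groups are the rings R_i, with product bimodM i i i; the left and
   right actions on B_{i,j} are bimodM i i j and bimodM i j j. The
   instances j = k, i = j and k = l of associativity say respectively that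
   the product is R_j-balanced, i.e. factors through the tensor product, and
   that phi is left R_i-linear and right R_k-linear. *)
Record formal_matrix_data (n : nat) := FormalMatrixData {
  bimod : 'I_n -> 'I_n -> zmodType;
  bimod1 : forall i, bimod i i;
  bimodM : forall i j k, bimod i j -> bimod j k -> bimod i k;
  bimodMDl : forall i j k (a a' : bimod i j) (b : bimod j k),
    bimodM (a + a') b = bimodM a b + bimodM a' b;
  bimodMDr : forall i j k (a : bimod i j) (b b' : bimod j k),
    bimodM a (b + b') = bimodM a b + bimodM a b';
  bimod1M : forall i j (a : bimod i j), bimodM (bimod1 i) a = a;
  bimodM1 : forall i j (a : bimod i j), bimodM a (bimod1 j) = a;
  bimodMA : forall i j k l (a : bimod i j) (b : bimod j k) (c : bimod k l),
    bimodM (bimodM a b) c = bimodM a (bimodM b c)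
}.

Section FormalMatrices.
Variables (n : nat) (D : formal_matrix_data n).

Definition corner_carrier (i : 'I_n) : Type := bimod D i i.
HB.instance Definition _ i := GRing.Zmodule.on (corner_carrier i).

Fact corner_mulA i : associative (@bimodM n D i i i : _ -> _ -> corner_carrier i).
Proof. by move=> a b c; rewrite bimodMA. Qed.

HB.instance Definition _ i := GRing.Zmodule_isPzRing.Build (corner_carrier i)
  (@corner_mulA i) (@bimod1M n D i i) (@bimodM1 n D i i)
  (fun a b c => @bimodMDl n D i i i a b c)
  (@bimodMDr n D i i i).

Definition corner (i : 'I_n) : pzRingType := corner_carrier i.

Definition fmatrix : Type :=
  {dffun forall p : 'I_n * 'I_n, bimod D p.1 p.2}.
HB.instance Definition _ := Choice.on fmatrix.

Definition fmx_of (F : forall i j, bimod D i j) : fmatrix :=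
  [ffun p : 'I_n * 'I_n => F p.1 p.2].

Definition entry (x : fmatrix) (i j : 'I_n) : bimod D i j := x (i, j).

Lemma entryE F i j : entry (fmx_of F) i j = F i j.
Proof. by rewrite /entry ffunE. Qed.

Lemma fmatrixP (x y : fmatrix) : (forall i j, entry x i j = entry y i j) <-> x = y.
Proof. by split=> [xy|->//]; apply/ffunP => -[i j]; exact: xy. Qed.

Definition fmx_zero : fmatrix := fmx_of (fun i j => 0).
Definition fmx_opp (x : fmatrix) : fmatrix := fmx_of (fun i j => - entry x i j).
Definition fmx_add (x y : fmatrix) : fmatrix :=
  fmx_of (fun i j => entry x i j + entry y i j).

Fact fmx_addA : associative fmx_add.
Proof. by move=> x y z; apply/fmatrixP => i j; rewrite !entryE addrA. Qed.
Fact fmx_addC : commutative fmx_add.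
Proof. by move=> x y; apply/fmatrixP => i j; rewrite !entryE addrC. Qed.
Fact fmx_add0 : left_id fmx_zero fmx_add.
Proof. by move=> x; apply/fmatrixP => i j; rewrite !entryE add0r. Qed.
Fact fmx_addN : left_inverse fmx_zero fmx_opp fmx_add.
Proof. by move=> x; apply/fmatrixP => i j; rewrite !entryE addNr. Qed.

HB.instance Definition _ :=
  GRing.isZmodule.Build fmatrix fmx_addA fmx_addC fmx_add0 fmx_addN.

(* The entry b at position (i, j) and zeros elsewhere; the transport is along
   the equality of the positions. *)
Definition fmx_delta (i j : 'I_n) (b : bimod D i j) : fmatrix :=
  [ffun p : 'I_n * 'I_n =>
    (if (i, j) =P p is ReflectT e
     then ecast q (bimod D q.1 q.2) e b else 0) : bimod D p.1 p.2].

Definition canonical_idem (i : 'I_n) : fmatrix := fmx_delta (bimod1 D i).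

Definition fmx_one : fmatrix := \sum_(i < n) canonical_idem i.

Definition fmx_mul (x y : fmatrix) : fmatrix :=
  fmx_of (fun i k => \sum_(j < n) bimodM (entry x i j) (entry y j k)).

Lemma bimod0M i j k (b : bimod D j k) : bimodM (0 : bimod D i j) b = 0.
Proof. by apply: (addIr (bimodM 0 b)); rewrite -bimodMDl !add0r. Qed.

Lemma bimodM0 i j k (a : bimod D i j) : bimodM a (0 : bimod D j k) = 0.
Proof. by apply: (addIr (bimodM a 0)); rewrite -bimodMDr !add0r. Qed.

Lemma bimodM_suml i j k (I : Type) (r : seq I) (P : pred I)
    (F : I -> bimod D i j) (b : bimod D j k) :
  bimodM (\sum_(t <- r | P t) F t) b = \sum_(t <- r | P t) bimodM (F t) b.
Proof.
exact: (big_morph (fun a => bimodM a b) (fun a a' => bimodMDl a a' b)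
  (bimod0M i b)).
Qed.

Lemma bimodM_sumr i j k (I : Type) (r : seq I) (P : pred I)
    (a : bimod D i j) (F : I -> bimod D j k) :
  bimodM a (\sum_(t <- r | P t) F t) = \sum_(t <- r | P t) bimodM a (F t).
Proof. exact: (big_morph (bimodM a) (bimodMDr a) (bimodM0 k a)). Qed.

Lemma entry_sum (I : Type) (r : seq I) (P : pred I) (F : I -> fmatrix) i j :
  entry (\sum_(t <- r | P t) F t) i j = \sum_(t <- r | P t) entry (F t) i j.
Proof.
by apply: (big_morph (fun x => entry x i j)) => [x y|]; rewrite entryE.
Qed.

Lemma entry_delta_id i j (b : bimod D i j) : entry (fmx_delta b) i j = b.
Proof.
rewrite /entry ffunE; case: eqP => [e|//].
by rewrite (eq_irrelevance e erefl).
Qed.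

Lemma entry_delta_out i j (b : bimod D i j) k l :
  (i, j) != (k, l) -> entry (fmx_delta b) k l = 0.
Proof. by rewrite /entry ffunE; case: eqP. Qed.

Lemma entry_one_id i : entry fmx_one i i = bimod1 D i.
Proof.
rewrite entry_sum (bigD1 i)//= entry_delta_id big1 ?addr0// => j ji.
by rewrite entry_delta_out// xpair_eqE negb_and ji.
Qed.

Lemma entry_one_out i j : i != j -> entry fmx_one i j = 0.
Proof.
move=> ij; rewrite entry_sum big1// => k _; rewrite entry_delta_out//.
by rewrite xpair_eqE; apply: contraNN ij => /andP[/eqP<- /eqP<-].
Qed.

Fact fmx_mulA : associative fmx_mul.
Proof.
move=> x y z; apply/fmatrixP => i l; rewrite !entryE.
under eq_bigr do rewrite entryE bimodM_sumr.
under [RHS]eq_bigr do rewrite entryE bimodM_suml.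
rewrite exchange_big /=; apply: eq_bigr => k _; apply: eq_bigr => j _.
by rewrite bimodMA.
Qed.

Fact fmx_mul1 : left_id fmx_one fmx_mul.
Proof.
move=> x; apply/fmatrixP => i j; rewrite entryE (bigD1 i)//= entry_one_id.
rewrite bimod1M big1 ?addr0// => k ki.
by rewrite entry_one_out ?bimod0M// eq_sym.
Qed.

Fact fmx_mulr1 : right_id fmx_one fmx_mul.
Proof.
move=> x; apply/fmatrixP => i j; rewrite entryE (bigD1 j)//= entry_one_id.
rewrite bimodM1 big1 ?addr0// => k ki.
by rewrite entry_one_out ?bimodM0.
Qed.

Fact fmx_mulDl : left_distributive fmx_mul +%R.
Proof.
move=> x y z; apply/fmatrixP => i j; rewrite !entryE -big_split /=.
by apply: eq_bigr => k _; rewrite entryE bimodMDl.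
Qed.

Fact fmx_mulDr : right_distributive fmx_mul +%R.
Proof.
move=> x y z; apply/fmatrixP => i j; rewrite !entryE -big_split /=.
by apply: eq_bigr => k _; rewrite entryE bimodMDr.
Qed.

HB.instance Definition _ := GRing.Zmodule_isPzRing.Build fmatrix
  fmx_mulA fmx_mul1 fmx_mulr1 fmx_mulDl fmx_mulDr.

Definition fmatrix_ring : pzRingType := fmatrix.

End FormalMatrices.

Record formal_matrix_ring (n : nat) := FormalMatrixRing {
  fm_data :> formal_matrix_data n;
  fm_local : forall i, local_ring (corner fm_data i)
}.

Section Nakayama.
Variables (n : nat) (R : formal_matrix_ring n).

Let e (i : 'I_n) : fmatrix_ring R := canonical_idem R i.

Definition basic : Prop :=
  forall i j, module_iso (right_principal (e i)) (right_principal (e j)) ->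
    i = j.

(* J(R) is the same subset of R on both sides. *)
Definition nakayama_permutation (s : 'S_n) : Prop :=
  let J : fmatrix_ring R -> Prop := @jacobson (fmatrix_ring R) in
  forall i,
    module_iso (submodule (soc (right_principal (e i))))
               (mod_top (right_principal (e (s i))) J) /\
    module_iso (submodule (soc (left_principal (e (s i)))))
               (mod_top (left_principal (e i)) J).

End Nakayama.

(* The indices 1, ..., n are represented by 0, ..., n - 1 : 'I_n, so that the
   cycle (1 2 ... n) is i |-> i + 1 modulo n. *)
Definition cycle_perm (n : nat) : 'S_n := perm (@ordS_inj n).

(* Main.v *)
Require Import Defs.
From mathcomp Require Import all_boot all_order all_algebra perm.
From HB Require Import structures.
From mathcomp Require Import generic_quotient ring_quotient boolp ring.

(** Fix a field F. All nonzero coordinate bimodules are taken to be copies of F,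
    placed on a relation S that is reflexive and satisfies S i j = S j (s i),
    where s is the required permutation. The product of B_{i,j} and B_{j,k} is
    the product of F when i = j, j = k or k = s i, and zero otherwise. So the
    only products off the diagonal are the pairings
    B_{i,j} x B_{j,s i} -> B_{i,s i}, which S i j = S j (s i) makes perfect; none
    of them can be continued by a further factor off the diagonal, and
    associativity is a comparison of cases.
    For the theorem, S is the set of positions listed in its statement, and the
    symmetry k <-> 1 - k of the offsets is exactly S i j = S j (s i). A fixed
    point i of s must be isolated in S; for the cycle it forces n = 1.

    The diagonal entries are ring homomorphisms from R onto F, as a loop
    B_{i,j} x B_{j,i} -> B_{i,i} is zero for i <> j. A matrix with zero diagonal
    has cube zero, so the Jacobson radical J consists of the
    matrices with zero diagonal ([jacobsonP]). Let z_i be the matrix unit at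
    (i, s i). Both x z_i and z_i x are multiples of z_i, by the diagonal entries
    i and s i of x. Perfectness of the pairings implies that every nonzero matrix
    has a left multiple and a right multiple of the form z_i
    ([reach_socle_left], [reach_socle_right]). Hence F z_i is the simple
    essential socle of e_i R and of R e_(s i), and multiplication of z_i
    identifies it with top(e_(s i) R), respectively top(R e_i), since its
    annihilator there is the radical ([soc_iso_top]).

    Left modules over R and over the converse ring are handled at once by a list
    of properties of (e_i), (z_i) and the diagonal entries, [socle_frame], which
    holds for R with s^-1 and for the converse ring with s, and from which the
    conclusions are deduced in an arbitrary ring. *)

Set Implicit Arguments.
Unset Strict Implicit.
Unset Printing Implicit Defensive.
Import GRing.Theory.
Local Open Scope ring_scope.

(** * Submodules, socle and top *)

Section Submodules.
Variables (A : pzRingType) (M : lmodType A).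

Lemma exists_submod (P : M -> Prop) :
    P 0 -> (forall a u v, P u -> P v -> P (a *: u + v)) ->
  exists N : submodClosed M, forall x, x \in N <-> P x.
Proof.
move=> P0 Plin; pose p : {pred M} := fun x => `[< P x >].
have p_closed : submod_closed p.
  split=> [|a u v /asboolP uP /asboolP vP]; apply/asboolP => //.
  exact: Plin.
pose N : submodClosed M := HB.pack p (GRing.isSubmodClosed.Build A M p p_closed).
by exists N => x; split=> [/asboolP|Px] //; apply/asboolP.
Qed.

Lemma mem_gen (X : M -> Prop) x : X x -> x \in gen X.
Proof. by move=> Xx; apply/asboolP => N; apply. Qed.

Lemma gen_min (X : M -> Prop) (N : submodClosed M) x :
  (forall y, X y -> y \in N) -> x \in gen X -> x \in N.
Proof. by move=> XN /asboolP; apply. Qed.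

End Submodules.

Section CyclicSocle.
Local Open Scope quotient_scope.
Variables (A : pzRingType) (M : lmodType A).

(** The hypothesis says that every nonzero submodule contains z, so that A z is
    the only simple submodule. *)
Lemma soc_cyclicP (z : M) :
    z <> 0 -> (forall v, v <> 0 -> exists a, a *: v = z) ->
  forall x, x \in soc M <-> exists a, x = a *: z.
Proof.
move=> z0 zmin x.
have [Z ZP] : exists Z : submodClosed M, forall y, y \in Z <-> exists a, y = a *: z.
  apply: exists_submod => [|a _ _ [b ->] [c ->]]; first by exists 0; rewrite scale0r.
  by exists (a * b + c); rewrite scalerDl scalerA.
have zZ : z \in Z by apply/ZP; exists 1; rewrite scale1r.
have Zmin L : nonzero_submod L -> {subset Z <= L}.
  move=> [v vL /zmin[a az]] _ /ZP[b ->].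
  by rewrite -az; do 2!apply: rpredZ.
have Z_simple : simple_submod Z by split=> [|L _ /Zmin//]; exists z.
rewrite -ZP; split=> [|xZ]; last by apply: mem_gen; exists Z.
apply: gen_min => y [N [N0 Nmin] yN]; apply: Nmin yN; first exact: Zmin.
by exists z.
Qed.

(** The map a f |-> a z from A f onto A z = soc M has kernel J f. The
    isomorphism is built in the direction soc M -> top(A f), where it sends a z
    to the class of a f. *)
Lemma soc_iso_top (z : M) (f : A) (J : A -> Prop) :
    z <> 0 -> (forall v, v <> 0 -> exists a, a *: v = z) ->
    f * f = f -> f *: z = z ->
    (forall a b, J a -> (a * b) *: z = 0) ->
    (forall a, a *: z = 0 -> J (a * f)) ->
  module_iso (submodule (soc M)) (mod_top (left_principal f) J).
Proof.
move=> z0 zmin ff fz Jz zJ; have socE := soc_cyclicP z0 zmin.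
pose K : submodClosed (left_principal f) :=
  gen (fun x => exists a y, J a /\ x = a *: y).
pose Q := Quotient.quot (sub_zmod K).
(* The underlying ring element, at type A, where it can act on M. *)
pose co (y : left_principal f) : A := val y.
have cof y : co y * f = co y.
  by have /asboolP[a cE] := valP y; rewrite /co cE -mulrA ff.
have fP (a : A) : (a * f : A^o) \in principal f by apply/asboolP; exists a.
pose af (a : A) : left_principal f := Sub (a * f : A^o) (fP a).
have afz a : co (af a) *: z = a *: z by rewrite /co SubK -scalerA fz.
have KP y : y \in K <-> co y *: z = 0.
  split=> [|/zJ]; last first.
    rewrite cof => Jy; apply: mem_gen; exists (co y), (af 1); split=> //.
    by apply: val_inj; rewrite -[RHS]/(co y * co (af 1)) {2}/co SubK mul1r cof.
  have [N NP] : exists N : submodClosed (left_principal f),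
      forall y, y \in N <-> co y *: z = 0.
    apply: exists_submod => [|a u v u0 v0]; first exact: scale0r.
    rewrite -[co _]/(a * co u + co v).
    by rewrite scalerDl -scalerA u0 v0 scaler0 addr0.
  move=> yK; apply/NP; apply: gen_min yK => _ [a [u [Ja ->]]].
  by apply/NP; rewrite -[co _]/(a * co u); exact: Jz.
have piP u v : \pi_Q u = \pi_Q v <-> co u *: z = co v *: z.
  split=> [/eqP|uv].
    rewrite -Quotient.idealrBE => /KP; rewrite -[co _]/(co u - co v).
    by rewrite scalerBl => /eqP; rewrite subr_eq0 => /eqP.
  apply/eqP; rewrite -Quotient.idealrBE; apply/KP; rewrite -[co _]/(co u - co v).
  by rewrite scalerBl uv subrr.
have lift (x : submodule (soc M)) : {a : A | val x = a *: z}.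
  exact/cid/socE/(valP x).
pose h (x : submodule (soc M)) : mod_top (left_principal f) J :=
  \pi_Q (af (sval (lift x))).
have h_eq x (u : left_principal f) : val x = co u *: z -> h x = \pi_Q u.
  by move=> xu; apply/piP; rewrite afz -(svalP (lift x)).
have h_lin : linear h.
  move=> a x y; rewrite (_ : h _ = \pi_Q (a *: af (sval (lift x)) + af (sval (lift y)))).
    by rewrite [LHS]raddfD; congr (_ + _);
      exact: esym (quot_scale_pi K a (af (sval (lift x)))).
  apply: h_eq; rewrite -[co _]/(a * co (af (sval (lift x))) + co (af (sval (lift y)))).
  rewrite scalerDl -scalerA.
  by rewrite !afz -(svalP (lift x)) -(svalP (lift y)).
have ann_soc u : co u *: z \in soc M by apply/socE; exists (co u).
pose sc u : submodule (soc M) := Sub (co u *: z) (ann_soc u).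
pose g (q : mod_top (left_principal f) J) := sc (repr (q : Q)).
pose hl : {linear submodule (soc M) -> mod_top (left_principal f) J} :=
  HB.pack h (GRing.isLinear.Build A _ _ _ h h_lin).
exists hl; exists g => [x|q].
  apply: val_inj; rewrite SubK [RHS](svalP (lift x)) -[RHS]afz.
  by apply: (piP _ _).1; rewrite reprK.
by rewrite -[RHS](@reprK _ Q); apply: h_eq.
Qed.

End CyclicSocle.

(** * Homomorphisms onto a field and the Jacobson radical *)

Section Characters.
Variables (F : fieldType) (A : pzRingType).

Record ring_character (chi : A -> F) : Prop := RingCharacter {
  charB : forall a b, chi (a - b) = chi a - chi b;
  charM : forall a b, chi (a * b) = chi a * chi b;
  char1 : chi 1 = 1;
  char_onto : forall c, exists a, chi a = c
}.

Section OneCharacter.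
Variables (chi : A -> F) (chiP : ring_character chi).

Lemma char0 : chi 0 = 0.
Proof. by have := charB chiP 0 0; rewrite !subrr. Qed.

Lemma charD a b : chi (a + b) = chi a + chi b.
Proof.
have -> : a + b = a - (0 - b) by rewrite sub0r opprK.
by rewrite !(charB chiP) char0 sub0r opprK.
Qed.

(** Every element outside the kernel is left invertible modulo the kernel. *)
Lemma char_scaled a : chi a <> 0 -> exists b, chi (1 - b * a) = 0.
Proof.
move=> /eqP a0; have [b bE] := char_onto chiP (chi a)^-1.
by exists b; rewrite (charB chiP) (charM chiP) (char1 chiP) bE mulVf ?subrr.
Qed.

Lemma char_ker_maximal : exists2 L : submodClosed A^o,
  maximal_submod L & forall a : A, (a : A^o) \in L <-> chi a = 0.
Proof.
have [L LP] : exists L : submodClosed A^o, forall a : A^o, a \in L <-> chi a = 0.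
  apply: exists_submod => [|a u v u0 v0]; first exact: char0.
  by rewrite charD (charM chiP) u0 v0 mulr0 addr0.
exists L => //; split=> [|N LN [x xN] y yN].
  exists 1; apply/negP => /LP/eqP; rewrite (char1 chiP).
  by rewrite oner_eq0.
apply/LP; apply: contrapT => /char_scaled[b /LP/LN byN].
suff : x \in N by rewrite (negPf xN).
have -> : x = x *: ((1 - b * y) + b *: y : A^o).
  by rewrite -[RHS]/(x * (1 - b * y + b * y)) subrK mulr1.
by apply: rpredZ; apply: rpredD => //; apply: rpredZ.
Qed.

End OneCharacter.

(** If 1 - x is nilpotent, then x is invertible. The proof shows by induction
    that 1 - (1 - x)^k is a left multiple of x. *)
Lemma one_mem_nil (L : submodClosed A^o) (x : A) k :
  (x : A^o) \in L -> (1 - x) ^+ k = 0 -> (1 : A^o) \in L.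
Proof.
move=> xL y0; suff : (1 - (1 - x) ^+ k : A^o) \in L by rewrite y0 subr0.
elim: k {y0} => [|k IHk]; first by rewrite expr0 subrr rpred0.
have -> : 1 - (1 - x) ^+ k.+1 = (1 - (1 - x) ^+ k) + (1 - x) ^+ k * x.
  rewrite exprSr mulrBr mulr1 opprB addrA.
  by rewrite [RHS]addrAC.
by apply: rpredD => //; apply: (@rpredZ _ _ L ((1 - x) ^+ k)).
Qed.

Lemma maximal_proper (L : submodClosed A^o) :
  maximal_submod L -> (1 : A^o) \notin L.
Proof.
move=> [[x xL] _]; apply: contra xL => oneL.
by rewrite -[x]mulr1; apply: (@rpredZ _ _ L x).
Qed.

(** Each kernel is a maximal left ideal, which bounds J from above. Conversely,
    if a lies in all kernels and not in a maximal left ideal L, then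
    1 + c a lies in L for some c; as c a is nilpotent, 1 + c a is invertible. *)
Lemma jacobsonP (I : Type) (chi : I -> A -> F) :
    (forall i, ring_character (chi i)) ->
    (forall a, (forall i, chi i a = 0) -> exists k, a ^+ k = 0) ->
  forall a, jacobson a <-> forall i, chi i a = 0.
Proof.
move=> chiP chi_nil a; split=> [aJ i|a0 L Lmax].
  by have [L Lmax <-] := char_ker_maximal (chiP i); exact: aJ.
apply: contrapT => /negP aL.
(* N is the left ideal L + A a. *)
have [N NP] : exists N : submodClosed A^o,
    forall x : A^o, x \in N <-> exists c : A, (x + c * a : A^o) \in L.
  apply: exists_submod => [|b u v [c uL] [d vL]].
    by exists 0; rewrite mul0r addr0 rpred0.
  exists (b * c + d).
  have -> : b *: u + v + (b * c + d) * a = b *: (u + c * a : A^o) + (v + d * a).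
    by rewrite scalerDr mulrDl -!mulrA addrACA.
  by apply: rpredD => //; apply: rpredZ.
suff /NP[c /one_mem_nil oneL] : (1 : A^o) \in N.
  have [i|k k0] := chi_nil (- (c * a)).
    by rewrite -sub0r (charB (chiP i)) (charM (chiP i)) (char0 (chiP i)) a0 mulr0 subrr.
  have /negP[] := maximal_proper Lmax.
  by apply: (oneL k); rewrite opprD addrA subrr add0r.
apply: contrapT => /negP oneN; have /negP[] := aL.
apply: Lmax.2.
- by move=> x xL; apply/NP; exists 0; rewrite mul0r addr0.
- by exists 1.
- by apply/NP; exists (-1); rewrite mulN1r subrr rpred0.
Qed.

(** A left ideal not contained in the kernel contains an element that is 1 modulo
    nilpotents, hence contains 1. *)
Lemma char_local (chi : A -> F) :
    ring_character chi -> (forall a, chi a = 0 -> exists k, a ^+ k = 0) ->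
  local_ring A.
Proof.
move=> chiP chi_nil; have [L Lmax LP] := char_ker_maximal chiP.
exists L => // N Nmax; have NL : {subset N <= L}.
  move=> x xN; apply/LP; apply: contrapT => /(char_scaled chiP)[b].
  move=> /chi_nil[k]; apply/eqP; apply: contra (maximal_proper Nmax).
  move=> /eqP; apply: one_mem_nil.
  exact: (@rpredZ _ _ N b).
move=> x; apply/idP/idP => [/NL//|]; apply: Nmax.2 => //; exact: Lmax.1.
Qed.

End Characters.

(** * Rings with simple socles matched to simple tops *)

Section SocleFrame.
Variables (F : fieldType) (A : pzRingType) (I : eqType) (p : I -> I).
Variables (e z : I -> A) (chi : I -> A -> F).

(** The left modules A e_i have the simple socles A z_i. The annihilator of z_i
    is the kernel of the character with index p i, so soc(A e_i) is isomorphic to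
    top(A e_(p i)); thus p is the Nakayama permutation on the side of the left
    modules. *)
Record socle_frame : Prop := SocleFrame {
  frame_char : forall i, ring_character (chi i);
  frame_nil : forall a, (forall i, chi i a = 0) -> exists k, a ^+ k = 0;
  frame_idem : forall i, e i * e i = e i;
  frame_chi_idem : forall i j, chi i (e j) = (i == j)%:R;
  frame_socle_idem : forall i j, z i * e j = if i == j then z i else 0;
  frame_ann : forall i a, a * z i = 0 <-> chi (p i) a = 0;
  frame_min : forall v, v <> 0 -> exists a i, a * v = z i
}.

Hypothesis frameP : socle_frame.

Lemma frame_socle_neq0 i : z i <> 0.
Proof.
rewrite -[z i]mul1r => /(frame_ann frameP)/eqP.
by rewrite (char1 (frame_char frameP _)) oner_eq0.
Qed.

Lemma frame_jacobson a : jacobson a <-> forall i, chi i a = 0.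
Proof. exact: jacobsonP (frame_char frameP) (frame_nil frameP) a. Qed.

Lemma frame_soc_top (J : A -> Prop) t :
    (forall a, J a <-> forall i, chi i a = 0) ->
  module_iso (submodule (soc (left_principal (e t))))
             (mod_top (left_principal (e (p t))) J).
Proof.
move=> JP; have ze : (z t : A^o) \in principal (e t).
  by apply/asboolP; exists (z t); rewrite (frame_socle_idem frameP) eqxx.
pose zt : left_principal (e t) := Sub (z t : A^o) ze.
have annP a : a *: zt = 0 <-> a * z t = 0.
  by split=> [/(congr1 val)|a0] //; apply: val_inj.
apply: (@soc_iso_top _ _ zt).
- by move=> /(congr1 val); exact: frame_socle_neq0.
- move=> v v0.
  have [/= v00|a [i avz]] := @frame_min frameP (val v).
    by apply: v0; apply: val_inj.
  exists a; apply: val_inj; rewrite -[LHS]/(a * val v : A) avz /=.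
  have /asboolP[b vE] := valP v.
  have : z i * e t = z i.
    by rewrite -avz vE -!mulrA (frame_idem frameP).
  rewrite (frame_socle_idem frameP); case: eqP => [->//|_ zi0].
  by case: (@frame_socle_neq0 i).
- exact: frame_idem.
- apply/eqP; rewrite -subr_eq0 -[X in _ - X]scale1r -scalerBl; apply/eqP/annP.
  apply/(frame_ann frameP); rewrite (charB (frame_char frameP _)).
  by rewrite (frame_chi_idem frameP) eqxx (char1 (frame_char frameP _)) subrr.
- move=> a b /JP a0; apply/annP/(frame_ann frameP).
  by rewrite (charM (frame_char frameP _)) a0 mul0r.
- move=> a /annP/(frame_ann frameP) a0; apply/JP => i.
  rewrite (charM (frame_char frameP _)) (frame_chi_idem frameP).
  by case: eqP => [->|_]; rewrite ?a0 ?mul0r ?mulr0.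
Qed.

(** Mutually inverse isomorphisms are right multiplications by elements w and w'
    with w w' = e_i, w in A e_j. The character with index i is 1 at e_i, but
    vanishes at w = w e_j when j differs from i. *)
Lemma frame_basic i j :
  module_iso (left_principal (e i)) (left_principal (e j)) -> i = j.
Proof.
move=> [g [h gK hK]].
have eP k : (e k : A^o) \in principal (e k).
  by apply/asboolP; exists 1; rewrite mul1r.
pose u k : left_principal (e k) := Sub (e k : A^o) (eP k).
have uE k (x : left_principal (e k)) : x = (val x : A) *: u k.
  apply: val_inj; have /asboolP[b xE] := valP x.
  by rewrite -[RHS]/((val x : A) * e k) xE -mulrA frame_idem.
have : u i = ((val (g (u i)) : A) * (val (h (u j)) : A)) *: u i.
  rewrite -scalerA -uE.
  by apply: (can_inj gK); rewrite linearZ /= hK -uE.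
move=> /(congr1 (fun x => chi i (val x))).
rewrite -[X in _ = chi i X]/((val (g (u i)) : A) * (val (h (u j)) : A) * e i).
have /asboolP[b ->] := valP (g (u i)).
rewrite !(charM (frame_char frameP _)) !(frame_chi_idem frameP) eqxx.
by have [//|_ /eqP] := eqVneq i j; rewrite mulr0 !mul0r oner_eq0.
Qed.

(** A z_i is simple: if b z_i is nonzero, then b is left invertible modulo the
    annihilator of z_i. *)
Lemma frame_socle_mem i : (z i : A^o) \in soc (A^o : lmodType A).
Proof.
have [Z ZP] : exists Z : submodClosed (A^o : lmodType A),
    forall y, y \in Z <-> exists a : A, y = a * z i.
  apply: exists_submod => [|a _ _ [b ->] [c ->]]; first by exists 0; rewrite mul0r.
  by exists (a * b + c); rewrite mulrDl -mulrA.
have zZ : (z i : A^o) \in Z by apply/ZP; exists 1; rewrite mul1r.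
apply: mem_gen; exists Z => //; split=> [|L LZ [v vL v0]].
  by exists (z i) => //; exact: frame_socle_neq0.
move=> _ /ZP[c ->]; have /ZP[b vE] := LZ _ vL.
have b0 : chi (p i) b <> 0 by move=> /(frame_ann frameP); rewrite -vE.
have [d d0] := char_scaled (frame_char frameP _) b0.
have dv : d *: v = z i.
  rewrite -[LHS]/(d * v) vE mulrA; apply/eqP; rewrite -subr_eq0 -opprB oppr_eq0.
  by rewrite -[X in X - _]mul1r -mulrBl; apply/eqP/(frame_ann frameP).
by rewrite -dv; apply: (@rpredZ _ _ L c); apply: rpredZ.
Qed.

Lemma frame_essential : essential_submod (soc (A^o : lmodType A)).
Proof.
move=> L [v vL v0]; have [a [i avz]] := frame_min frameP v0.
exists (z i); split; [|exact: frame_socle_mem|exact: frame_socle_neq0].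
by rewrite -avz; apply: (@rpredZ _ _ L a).
Qed.

End SocleFrame.

(** * Coordinate bimodules: F or zero *)

Section Cells.
Variables (F : fieldType) (b : bool).

Definition cell_pred : {pred F} := fun x => b || (x == 0).

Lemma cell_closed : zmod_closed cell_pred.
Proof.
rewrite /cell_pred; split=> [|x y]; rewrite !unfold_in ?eqxx ?orbT //.
by case: b => //= /eqP-> /eqP->; rewrite subrr eqxx.
Qed.

HB.instance Definition _ := GRing.isZmodClosed.Build F cell_pred cell_closed.

(** The group F if b holds, and the zero group otherwise. Encoding both cases as
    subgroups of F lets all identities be checked in F. *)
Definition cell : Type := {x : F | x \in cell_pred}.
HB.instance Definition _ := SubChoice.on cell.
HB.instance Definition _ := [SubChoice_isSubZmodule of cell by <:].

Fact cell_of_subproof (x : F) : (if b then x else 0) \in cell_pred.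
Proof. by rewrite unfold_in; case: b => //=; rewrite eqxx. Qed.

Definition cell_of (x : F) : cell := Sub (if b then x else 0) (cell_of_subproof x).

Lemma val_cell_of x : val (cell_of x) = if b then x else 0.
Proof. exact: SubK. Qed.

Lemma val_cell_of_in x : b -> val (cell_of x) = x.
Proof. by rewrite val_cell_of => ->. Qed.

Lemma val_cell (x : cell) : ~~ b -> val x = 0.
Proof. by have := valP x; rewrite unfold_in => /orP[->//|/eqP->]. Qed.

Lemma val_cellD (x y : cell) : val (x + y) = val x + val y.
Proof. exact: raddfD. Qed.

End Cells.

(** * The formal matrix ring of a self-dual relation *)

Section PairingRing.
Variables (F : fieldType) (n : nat) (S : rel 'I_n) (s : 'S_n).

Hypothesis S_refl : reflexive S.
Hypothesis S_dual : forall i j, S i j = S j (s i).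
Hypothesis S_fix : forall i j, s i = i -> S i j -> i = j.

Definition composable (i j k : 'I_n) : bool := [|| i == j, j == k | k == s i].

(** If i, j, k, l are consecutively distinct, then both sides are false: two
    nontrivial products in a row would require a fixed point of s related by S to
    another index. *)
Lemma composable_assoc i j k l : S i j -> S j k -> S k l ->
  composable i j k && composable i k l = composable i j l && composable j k l.
Proof.
move=> Sij Sjk Skl; rewrite /composable.
have [->|ij] := eqVneq i j; first by rewrite ?eqxx.
have [jk|jk] := eqVneq j k; first by rewrite -jk (negPf ij) /= andbT.
have [kl|kl] := eqVneq k l; first by rewrite -kl (negPf jk) !orbT !andbT.
rewrite /=; transitivity false; last apply/esym; apply/negbTE/negP.
  move=> /andP[/eqP ks /orP[/eqP ik|/eqP ls]].
    by move/eqP: ij; apply; apply: S_fix Sij; rewrite -ks -ik.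
  by rewrite ks ls eqxx in kl.
move=> /andP[/orP[/eqP jl|/eqP ls] /eqP lj].
  by move/eqP: jk; apply; apply: S_fix Sjk; rewrite -lj -jl.
by move/eqP: ij; apply; apply: (@perm_inj _ s); rewrite -ls -lj.
Qed.

Definition pairing_mul i j k (a : cell F (S i j)) (b : cell F (S j k)) :
    cell F (S i k) :=
  cell_of _ (if composable i j k then val a * val b else 0).

Lemma S_composable i j k : S i j -> S j k -> composable i j k -> S i k.
Proof.
move=> Sij Sjk /or3P[/eqP->//|/eqP<-//|/eqP->]; rewrite -S_dual; exact: S_refl.
Qed.

Lemma val_pairing_mul i j k (a : cell F (S i j)) (b : cell F (S j k)) :
  val (pairing_mul a b) = if composable i j k then val a * val b else 0.
Proof.
rewrite val_cell_of; case: ifPn => // /negP Sik; case: ifP => // ijk.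
have [Sij|Sij] := orP (orbN (S i j)); last by rewrite (val_cell a) ?mul0r.
have [Sjk|Sjk] := orP (orbN (S j k)); last by rewrite (val_cell b) ?mulr0.
by case: Sik; apply: S_composable ijk.
Qed.

Lemma pairing_mulDl i j k (a a' : cell F (S i j)) (b : cell F (S j k)) :
  pairing_mul (a + a') b = pairing_mul a b + pairing_mul a' b.
Proof.
apply: val_inj; rewrite val_cellD !val_pairing_mul val_cellD.
by case: ifP; rewrite ?addr0 ?mulrDl.
Qed.

Lemma pairing_mulDr i j k (a : cell F (S i j)) (b b' : cell F (S j k)) :
  pairing_mul a (b + b') = pairing_mul a b + pairing_mul a b'.
Proof.
apply: val_inj; rewrite val_cellD !val_pairing_mul val_cellD.
by case: ifP; rewrite ?addr0 ?mulrDr.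
Qed.

Lemma pairing_1mul i j (a : cell F (S i j)) :
  pairing_mul (cell_of (S i i) 1) a = a.
Proof.
by apply: val_inj; rewrite val_pairing_mul val_cell_of S_refl /composable eqxx mul1r.
Qed.

Lemma pairing_mul1 i j (a : cell F (S i j)) :
  pairing_mul a (cell_of (S j j) 1) = a.
Proof.
apply: val_inj; rewrite val_pairing_mul val_cell_of S_refl /composable eqxx.
by rewrite orbT mulr1.
Qed.

Lemma pairing_mulA i j k l (a : cell F (S i j)) (b : cell F (S j k))
    (c : cell F (S k l)) :
  pairing_mul (pairing_mul a b) c = pairing_mul a (pairing_mul b c).
Proof.
apply: val_inj; rewrite !val_pairing_mul.
have [Sij|Sij] := orP (orbN (S i j)); last by rewrite (val_cell a)// !(mul0r, if_same).
have [Sjk|Sjk] := orP (orbN (S j k)).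
  have [Skl|Skl] := orP (orbN (S k l)); last by rewrite (val_cell c)// !(mulr0, if_same).
  have := composable_assoc Sij Sjk Skl.
  by do 4!case: (composable _ _ _) => //=; rewrite ?mulrA ?mulr0 ?mul0r.
by rewrite (val_cell b)// !(mul0r, mulr0, if_same).
Qed.

Definition pairing_data : formal_matrix_data n :=
  FormalMatrixData pairing_mulDl pairing_mulDr pairing_1mul pairing_mul1 pairing_mulA.

Local Notation R := (fmatrix_ring pairing_data).

Definition coef (x : R) i j : F := val (entry x i j : cell F (S i j)).

Lemma coefP (x y : R) : (forall i j, coef x i j = coef y i j) -> x = y.
Proof. by move=> xy; apply/fmatrixP => i j; apply: val_inj; exact: xy. Qed.

Lemma coef0 i j : coef 0 i j = 0.
Proof. by rewrite /coef entryE. Qed.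

Lemma coefB x y i j : coef (x - y) i j = coef x i j - coef y i j.
Proof. by rewrite /coef !entryE. Qed.

Lemma coef_out x i j : ~~ S i j -> coef x i j = 0.
Proof. exact: val_cell. Qed.

Lemma coefM x y i k :
  coef (x * y) i k =
    \sum_j (if composable i j k then coef x i j * coef y j k else 0).
Proof.
rewrite /coef entryE raddf_sum /=; apply: eq_bigr => j _.
exact: val_pairing_mul.
Qed.

Definition matrix_unit i j (c : F) : R :=
  @fmx_delta n pairing_data i j (cell_of (S i j) c).

Lemma coef_matrix_unit i j c k l : S i j ->
  coef (matrix_unit i j c) k l = if (i == k) && (j == l) then c else 0.
Proof.
move=> Sij; rewrite /coef -xpair_eqE.
have [[<- <-]|ijkl] := eqVneq (i, j) (k, l).
  by rewrite [entry _ _ _]entry_delta_id val_cell_of Sij.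
by rewrite [entry _ _ _]entry_delta_out.
Qed.


Lemma coef_unitM i j c x k l : S i j ->
  coef (matrix_unit i j c * x) k l =
    if (i == k) && composable i j l then c * coef x j l else 0.
Proof.
move=> Sij; rewrite coefM (bigD1 j) //= big1 ?addr0 => [|t tj].
  rewrite coef_matrix_unit // eqxx andbT.
  by have [->|_] := eqVneq i k; rewrite ?mul0r ?if_same.
by rewrite coef_matrix_unit // [j == t]eq_sym (negPf tj) andbF mul0r if_same.
Qed.

Lemma coef_Munit i j c x k l : S i j ->
  coef (x * matrix_unit i j c) k l =
    if (j == l) && composable k i j then coef x k i * c else 0.
Proof.
move=> Sij; rewrite coefM (bigD1 i) //= big1 ?addr0 => [|t ti].
  rewrite coef_matrix_unit // eqxx /=.
  by have [->|_] := eqVneq j l; rewrite ?mulr0 ?if_same.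
by rewrite coef_matrix_unit // [i == t]eq_sym (negPf ti) mulr0 if_same.
Qed.

Lemma S_pair i : S i (s i).
Proof. by rewrite -S_dual. Qed.

Lemma S_fix_l i k : s i = i -> S k i -> k = i.
Proof.
move=> si; rewrite S_dual => /(S_fix si) isk.
by apply: (@perm_inj _ s); rewrite -isk si.
Qed.

(** The elements of the socle of e_i R, which is also the socle of R e_(s i). *)
Definition socle_unit i c : R := matrix_unit i (s i) c.

Lemma coef_socle_unit i c k l :
  coef (socle_unit i c) k l = if (i == k) && (s i == l) then c else 0.
Proof. by rewrite coef_matrix_unit // S_pair. Qed.

Lemma socle_unitM i c x :
  socle_unit i c * x = socle_unit i (c * coef x (s i) (s i)).
Proof.
apply: coefP => k l; rewrite coef_unitM ?S_pair // coef_socle_unit.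
have [ik|//] := eqVneq i k; rewrite /= {k ik} /composable (eq_sym l) orbb.
have [->|sl] := eqVneq (s i) l; first by rewrite orbT.
rewrite orbF; case: eqP => // si; rewrite coef_out ?mulr0 //.
by apply: contra_neqN sl => /S_fix <-; rewrite // -si.
Qed.

Lemma Msocle_unit i c x : x * socle_unit i c = socle_unit i (coef x i i * c).
Proof.
apply: coefP => k l; rewrite coef_Munit ?S_pair // coef_socle_unit andbC.
have [_|_] := eqVneq (s i) l; rewrite ?andbF // !andbT /composable.
rewrite (inj_eq (@perm_inj _ s)) [k == i]eq_sym.
have [->|ik] := eqVneq i k; first by rewrite orbT.
rewrite orbF; case: eqP => // si; rewrite coef_out ?mul0r //.
by apply: contra_neqN ik => /S_fix_l ->.
Qed.

Lemma socle_unit_eq0 i c : socle_unit i c = 0 <-> c = 0.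
Proof.
split=> [/(congr1 (fun x => coef x i (s i)))|->].
  by rewrite coef_socle_unit !eqxx coef0.
by apply: coefP => k l; rewrite coef_socle_unit coef0 if_same.
Qed.

Lemma coefM_diag x y i : coef (x * y) i i = coef x i i * coef y i i.
Proof.
rewrite coefM (bigD1 i) //= big1 ?addr0 => [|j ji]; first by rewrite /composable eqxx.
case: ifP => // /or3P[/eqP ij|/eqP ij|/eqP si]; try by rewrite ij eqxx in ji.
rewrite coef_out ?mul0r //; apply: contra_neqN ji => /S_fix <- //; exact: esym.
Qed.

(** The square lives at the positions (i, s i), and a product of two entries off
    the diagonal cannot be continued. *)
Lemma cube_eq0 x : (forall i, coef x i i = 0) -> x * x * x = 0.
Proof.
move=> x0; have sq0 i k : k != s i -> coef (x * x) i k = 0.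
  move=> /negPf ksi; rewrite coefM big1 // => j _; rewrite /composable ksi orbF.
  by case: ifP => // /orP[] /eqP ->; rewrite x0 ?mul0r ?mulr0.
apply: coefP => i l; rewrite coef0 coefM big1 // => k _.
case: ifP => // /or3P[/eqP <-|/eqP ->|/eqP ->].
- by rewrite coefM_diag !x0 !mul0r.
- by rewrite x0 mulr0.
- by have [->|/sq0 ->] := eqVneq k (s i); rewrite ?x0 ?mulr0 ?mul0r.
Qed.

(** The right choice of an entry of x to be moved into the socle: one on the
    diagonal if possible, else one away from the positions (k, s k) if possible.
    This guarantees that no other entry survives the multiplication by the
    matrix unit that moves it. *)
Lemma nonzero_coef x : x <> 0 ->
  (exists i, coef x i i != 0) \/
  (forall i, coef x i i = 0) /\
  exists i j, coef x i j != 0 /\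
    (j != s i \/ forall k l, l != s k -> coef x k l = 0).
Proof.
move=> x0; have [xd|/forallNP xd] := pselect (exists i, coef x i i != 0); [by left|right].
split=> [i|]; first by apply/eqP; apply: contrapT => /negP; exact: xd.
have [[i [j [xij jsi]]]|offs] := pselect (exists i j, coef x i j != 0 /\ j != s i).
  by exists i, j; split=> //; left.
have {}offs k l : l != s k -> coef x k l = 0.
  move=> lsk; apply/eqP; apply: contrapT => /negP xkl.
  by apply: offs; exists k, l.
suff [i [j xij]] : exists i j, coef x i j != 0 by exists i, j; split=> //; right.
apply: contrapT => nox; apply: x0; apply: coefP => i j; rewrite coef0.
by apply/eqP; apply: contrapT => /negP xij; apply: nox; exists i, j.
Qed.

Lemma reach_socle_right x : x <> 0 -> exists a i, x * a = socle_unit i 1.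
Proof.
move=> /nonzero_coef[[i xi]|[x0 [i [j [xij off]]]]].
  exists (socle_unit i (coef x i i)^-1), i.
  by rewrite Msocle_unit mulfV.
have Sjsi : S j (s i).
  by rewrite -S_dual; apply: contraNT xij => /coef_out ->.
exists (matrix_unit j (s i) (coef x i j)^-1), i.
apply: coefP => k l; rewrite coef_Munit // coef_socle_unit [i == k]eq_sym andbC.
have [_|_] := eqVneq (s i) l; rewrite ?andbF // !andbT.
have [->|ki] := eqVneq k i; first by rewrite /composable eqxx !orbT mulfV.
rewrite /composable (inj_eq (@perm_inj _ s)) [i == k]eq_sym (negPf ki) orbF.
case: ifP => // /orP[/eqP->|/eqP jsi]; first by rewrite x0 mul0r.
case: off => [|->]; rewrite ?jsi ?eqxx ?mul0r //.
by rewrite (inj_eq (@perm_inj _ s)) eq_sym.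
Qed.

Lemma reach_socle_left x : x <> 0 -> exists a i, a * x = socle_unit i 1.
Proof.
move=> /nonzero_coef[[i xi]|[x0 [i [j [xij off]]]]].
  exists (socle_unit ((s^-1)%g i) (coef x i i)^-1), ((s^-1)%g i).
  by rewrite socle_unitM permKV mulVf.
have [t jE] : exists t, j = s t by exists ((s^-1)%g j); rewrite permKV.
have Sti : S t i by rewrite S_dual -jE; apply: contraNT xij => /coef_out ->.
exists (matrix_unit t i (coef x i j)^-1), t.
apply: coefP => k l; rewrite coef_unitM // coef_socle_unit -jE.
have [_|//] := eqVneq t k; rewrite /= eq_sym /composable -jE.
have [->|lj] := eqVneq l j; first by rewrite !orbT mulVf.
rewrite orbF; case: ifP => // /orP[/eqP ti|/eqP->]; last by rewrite x0 mulr0.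
case: off => [|off]; first by rewrite -ti -jE eqxx.
by rewrite (off i l) ?mulr0 // -ti -jE.
Qed.

Lemma pairing_local i : local_ring (corner pairing_data i).
Proof.
pose chi (a : corner pairing_data i) : F := val (a : cell F (S i i)).
apply: (@char_local _ _ chi) => [|a a0]; last by exists 1; apply: val_inj.
split=> // [a b||c].
- by rewrite /chi [LHS]val_pairing_mul /composable eqxx.
- by rewrite /chi [LHS]val_cell_of S_refl.
- by exists (cell_of (S i i) c); rewrite /chi val_cell_of S_refl.
Qed.

Definition pairing_ring : formal_matrix_ring n := FormalMatrixRing pairing_local.

Lemma coef_idem i j k :
  coef (canonical_idem pairing_data i) j k = ((i == j) && (i == k))%:R.
Proof. by rewrite [LHS]coef_matrix_unit ?S_refl //; case: ifP. Qed.

Lemma idemM i x j k :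
  coef ((canonical_idem pairing_data i : R) * x) j k = if i == j then coef x i k else 0.
Proof.
rewrite [LHS]coef_unitM ?S_refl // /composable eqxx /= andbT mul1r.
by case: eqP.
Qed.

Lemma coef_diag_char i : ring_character (fun x : R => coef x i i).
Proof.
split=> [a b|a b||c]; first exact: coefB.
- exact: coefM_diag.
- by rewrite /coef [entry _ _ _]entry_one_id val_cell_of S_refl.
- by exists (matrix_unit i i c); rewrite coef_matrix_unit ?S_refl // eqxx.
Qed.

(** The socle of R e_t is spanned by the matrix unit at (s^-1 t, t). *)
Lemma left_frame : @socle_frame F R 'I_n (s^-1)%g
  (fun i => canonical_idem pairing_data i) (fun i => socle_unit ((s^-1)%g i) 1)
  (fun i x => coef x i i).
Proof.
split=> [|a a0|i|i j|i j|i a|v /reach_socle_left[a [i av]]].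
- exact: coef_diag_char.
- by exists 3; rewrite !exprSr expr0 mul1r cube_eq0.
- apply: coefP => j k; rewrite idemM !coef_idem.
  by case: eqP => // _; rewrite eqxx.
- by rewrite coef_idem andbb eq_sym.
- rewrite socle_unitM permKV coef_idem andbb mul1r eq_sym.
  by case: eqP => // _; apply/socle_unit_eq0.
- by rewrite Msocle_unit mulr1; exact: socle_unit_eq0.
- by exists a, (s i); rewrite permK.
Qed.

Lemma right_frame : @socle_frame F R^c 'I_n s
  (fun i => canonical_idem pairing_data i) (fun i => socle_unit i 1)
  (fun i x => coef x i i).
Proof.
split=> [i|a a0|i|i j|i j|i a|v /reach_socle_right[a [i av]]].
- have [cB cM c1 onto] := coef_diag_char i; split=> // a b.
  by rewrite mulrC; exact: cM.
- by exists 3; exact: cube_eq0.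
- exact: (frame_idem left_frame).
- exact: (frame_chi_idem left_frame).
- rewrite [LHS]Msocle_unit coef_idem andbb mulr1 eq_sym.
  by case: eqP => // _; apply/socle_unit_eq0.
- by rewrite [a * _]socle_unitM mul1r; exact: socle_unit_eq0.
- by exists a, i.
Qed.

Theorem pairing_ring_nakayama :
  [/\ basic pairing_ring, nakayama_permutation pairing_ring s,
      essential_right_socle (fmatrix_ring pairing_ring) &
      forall i j, (exists b : bimod pairing_ring i j, b <> 0) <-> S i j].
Proof.
split=> [i j|J i||i j].
- exact: (frame_basic right_frame).
- have JP := frame_jacobson left_frame; split.
    exact: (frame_soc_top right_frame).
  by have := frame_soc_top left_frame (s i) JP; rewrite permK.
- exact: (frame_essential right_frame).
- split=> [[b b0]|Sij].
    by apply: contrapT => /negP /(val_cell b) bz; apply: b0; apply: val_inj.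
  exists (cell_of (S i j) 1 : cell F (S i j)) => /(congr1 val).
  rewrite val_cell_of_in // => one0.
  by have /eqP := one0 : 1 = 0 :> F; rewrite oner_eq0.
Qed.

End PairingRing.

(** * The support prescribed by a set of offsets *)

Section Support.
Variables (n : nat) (I : {set 'I_n}).

Local Notation s := (cycle_perm n).

Definition offset_in (i j k : 'I_n) : bool :=
  (j%:Z == i%:Z + k%:Z %[mod n%:Z])%Z || (j%:Z == i%:Z - k%:Z + 1 %[mod n%:Z])%Z.

Definition support (i j : 'I_n) : bool :=
  [|| i == j, j == s i | [exists k in I, offset_in i j k]].

Lemma cycle_permE i : ((s i)%:Z = i%:Z + 1 %[mod n%:Z])%Z.
Proof. by rewrite permE /= -PoszD addn1 !modz_nat modn_mod. Qed.

(** The two congruences are exchanged when (i, j) is replaced by (j, s i), that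
    is, when the offset d = j - i is replaced by 1 - d. *)
Lemma offset_in_dual i j k : offset_in j (s i) k = offset_in i j k.
Proof.
have dvdzN m : (n %| m)%Z = (n %| - m)%Z by rewrite !dvdzE abszN.
rewrite /offset_in !cycle_permE orbC; congr (_ || _); rewrite !eqz_mod_dvd.
  by rewrite dvdzN; congr (_ %| _)%Z; ring.
by rewrite dvdzN; congr (_ %| _)%Z; ring.
Qed.

Lemma support_refl : reflexive support.
Proof. by move=> i; rewrite /support eqxx. Qed.

Lemma support_dual i j : support i j = support j (s i).
Proof.
rewrite /support (inj_eq (@perm_inj _ s)) orbCA; do 2!congr (_ || _).
by apply: eq_existsb => k; rewrite offset_in_dual.
Qed.

Lemma support_fix i j : s i = i -> support i j -> i = j.
Proof.
move=> /(congr1 val) /= ; rewrite permE /= => si _.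
have n1 : n = 1%N.
  have := ltn_ord i; rewrite leq_eqVlt => /orP[/eqP iE|ltin].
    by rewrite iE modnn in si; rewrite -iE -si.
  by move: si; rewrite modn_small // => /eqP; rewrite eqn_leq ltnn.
have ordE (k : 'I_n) : val k = 0%N.
  by apply/eqP; rewrite -leqn0 -ltnS -n1 ltn_ord.
by apply: val_inj; rewrite !ordE.
Qed.

End Support.

Theorem proposition20 (n : nat) (n_gt0 : (0 < n)%N) (I : {set 'I_n})
    (I_ge2 : forall k : 'I_n, k \in I -> (2 <= k)%N) :
  exists R : formal_matrix_ring n,
    [/\ basic R,
        nakayama_permutation R (cycle_perm n),
        essential_right_socle (fmatrix_ring R) &
        forall i j : 'I_n,
          (exists b : bimod R i j, b <> 0) <->
          [\/ i = j,
              j = cycle_perm n i |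
              exists2 k : 'I_n, k \in I &
                (j%:Z = i%:Z + k%:Z %[mod n%:Z])%Z \/
                (j%:Z = i%:Z - k%:Z + 1 %[mod n%:Z])%Z]].
Proof.
pose R := pairing_ring rat (@support_refl n I) (@support_dual n I) (@support_fix n I).
have [Rbasic Rnak Ress Rsupp] :=
  pairing_ring_nakayama rat (@support_refl n I) (@support_dual n I) (@support_fix n I).
exists R; split=> // i j; split=> [/Rsupp/or3P[/eqP|/eqP|/existsP[k]]|ij].
- by constructor 1.
- by constructor 2.
- case/andP=> kI kij; constructor 3; exists k => //.
  by case/orP: kij => /eqP; [left|right].
- apply/Rsupp/or3P; case: ij => [->|->|[k kI kij]].
  + by constructor 1.
  + by constructor 2.
  + constructor 3; apply/existsP; exists k; rewrite kI /=; apply/orP.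
    by case: kij => /eqP; [left|right].
Qed.
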